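(* Let $\mathcal{B}\subseteq\omega^\omega$ be any mass problem. Let $n\geq1$ and let $f_1,\ldots,f_n\in\omega^\omega$ be pairwise Turing-incomparable such that $\{f_i\}\not\geq_M\mathcal{B}$ for every $i$. Then the interval of Medvedev degrees $$[\deg_M(\mathcal{B}\times\{f_1,\ldots,f_n\}),\ \deg_M(\mathcal{B}\times\{f_1\}'\times\cdots\times\{f_n\}')]$$ (ordered by $\leq_M$) is isomorphic to the Boolean algebra $\mathfrak{2}^n$ of all subsets of $\{0,\ldots,n-1\}$ under inclusion.
   Context: A mass problem is a subset of $\omega^\omega$. $\mathcal{A}\leq_M\mathcal{B}$ means there is a partial computable functional $\Psi$ defined on all of $\mathcal{B}$ with $\Psi(\mathcal{B})\subseteq\mathcal{A}$; $\deg_M(\mathcal{A})$ is the $\equiv_M$-equivalence class of $\mathcal{A}$, and the Medvedev lattice is the set of such degrees with the induced order. For $n\in\omega$, $n\,\widehat{\ }\,\mathcal{A}=\{n\,\widehat{\ }\,f:f\in\mathcal{A}\}$ and $\mathcal{A}\times\mathcal{B}=0\,\widehat{\ }\,\mathcal{A}\cup1\,\widehat{\ }\,\mathcal{B}$ (iterated finite products are taken in the evident way). For $f\in\omega^\omega$, $\{f\}'=\{m\,\widehat{\ }\,g: f<_T g\wedge\Phi_m(g)=f\}$, where $\Phi_m$ is the $m$-th partial computable functional. For degrees $\mathbf{a}\leq\mathbf{b}$, $[\mathbf{a},\mathbf{b}]=\{\mathbf{x}:\mathbf{a}\leq\mathbf{x}\leq\mathbf{b}\}$. *)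

(* Defs.v *)
From Stdlib Require Cantor.
From HB Require Import structures.
From mathcomp Require Import all_boot.
From mathcomp Require Import boolp classical_sets functions.

Set Implicit Arguments.
Unset Strict Implicit.
Unset Printing Implicit Defensive.

Local Open Scope classical_set_scope.

Definition baire := nat -> nat.

Definition npair (a b : nat) : nat := Cantor.to_nat (a, b).
Definition nfst (n : nat) : nat := (Cantor.of_nat n).1.
Definition nsnd (n : nat) : nat := (Cantor.of_nat n).2.

(* Kleene's partial recursive functions relative to an oracle, presented as
   unary functions; several arguments are passed through the bijection npair. *)
Inductive code : Type :=
  | CZero
  | CSucc
  | CFst
  | CSnd
  | COracle
  | CPair of code & code
  | CComp of code & code
  | CRec of code & code
  | CMu of code.

(* [eval g c x y]: with oracle g, program c halts on input x with output y.
   CRec c d sends <a, 0> to c(a) and <a, k+1> to d<a, <k, y>>, where y is its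
   value at <a, k>; CMu c sends a to the least m with c<a, m> = 0, provided
   c<a, k> converges for all k < m. *)
Fixpoint eval (g : baire) (c : code) : nat -> nat -> Prop :=
  match c with
  | CZero => fun _ y => y = 0
  | CSucc => fun x y => y = x.+1
  | CFst => fun x y => y = nfst x
  | CSnd => fun x y => y = nsnd x
  | COracle => fun x y => y = g x
  | CPair c d => fun x y =>
      exists y1 y2, [/\ eval g c x y1, eval g d x y2 & y = npair y1 y2]
  | CComp c d => fun x y => exists2 z, eval g d x z & eval g c z y
  | CRec c d => fun x =>
      (fix rec (k : nat) : nat -> Prop :=
         match k with
         | 0 => fun y => eval g c (nfst x) y
         | k.+1 => fun y =>
             exists2 z, rec k z & eval g d (npair (nfst x) (npair k z)) y
         end) (nsnd x)
  | CMu c => fun x y =>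
      eval g c (npair x y) 0 /\
      (forall k, k < y -> exists z, eval g c (npair x k) z.+1)
  end.

Fixpoint code_num (c : code) : nat :=
  match c with
  | CZero => npair 0 0
  | CSucc => npair 1 0
  | CFst => npair 2 0
  | CSnd => npair 3 0
  | COracle => npair 4 0
  | CPair c d => npair 5 (npair (code_num c) (code_num d))
  | CComp c d => npair 6 (npair (code_num c) (code_num d))
  | CRec c d => npair 7 (npair (code_num c) (code_num d))
  | CMu c => npair 8 (code_num c)
  end.

Lemma npair_inj a b a' b' : npair a b = npair a' b' -> a = a' /\ b = b'.
Proof. by move/Cantor.to_nat_inj => [-> ->]. Qed.

Lemma code_num_inj : injective code_num.
Proof.
elim=> [|||||c IHc d IHd|c IHc d IHd|c IHc d IHd|c IHc] [|||||c' d'|c' d'|c' d'|c'];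
  move=> /npair_inj[] // _.
- by case/npair_inj => /IHc -> /IHd ->.
- by case/npair_inj => /IHc -> /IHd ->.
- by case/npair_inj => /IHc -> /IHd ->.
- by move/IHc => ->.
Qed.

Lemma eval_functional g c x y y' : eval g c x y -> eval g c x y' -> y = y'.
Proof.
elim: c x y y' => [|||||c IHc d IHd|c IHc d IHd|c IHc d IHd|c IHc] x y y' /=;
  try by move=> -> ->.
- move=> [a [b [ca db ->]]] [a' [b' [ca' db' ->]]].
  by rewrite (IHc _ _ _ ca ca') (IHd _ _ _ db db').
- move=> [z dz cz] [z' dz' cz']; move: cz'.
  by rewrite -(IHd _ _ _ dz dz') => /(IHc _ _ _ cz).
- elim: (nsnd x) y y' => [|k IHk] y y'; first exact: IHc.
  move=> [z rz dz] [z' rz' dz']; move: dz'.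
  by rewrite -(IHk _ _ rz rz') => /(IHd _ _ _ dz).
- move=> [cy lty] [cy' lty'].
  case: (ltngtP y y') => // lt.
  + by have [z /IHc /(_ cy)] := lty' _ lt.
  + by have [z /IHc /(_ cy')] := lty _ lt.
Qed.

(* [Phi m g f]: the m-th partial computable functional is defined at g, with
   value f.  When m is not the number of a program, it is nowhere defined. *)
Definition Phi (m : nat) (g f : baire) : Prop :=
  exists2 c, code_num c = m & forall x, eval g c x (f x).

Definition turing_le (f g : baire) : Prop := exists m, Phi m g f.

Definition turing_lt (f g : baire) : Prop :=
  turing_le f g /\ ~ turing_le g f.

Definition turing_incomparable (f g : baire) : Prop :=
  ~ turing_le f g /\ ~ turing_le g f.

Definition mass_problem := set baire.

Definition medvedev_le (A B : mass_problem) : Prop :=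
  exists m, forall g, B g -> exists2 f, A f & Phi m g f.

Definition medvedev_equiv (A B : mass_problem) : Prop :=
  medvedev_le A B /\ medvedev_le B A.

Definition baire_cons (n : nat) (f : baire) : baire :=
  fun x => if x is k.+1 then f k else n.

Definition mass_prod (A B : mass_problem) : mass_problem :=
  (baire_cons 0 @` A) `|` (baire_cons 1 @` B).

(* A0 x A1 x ... x An, associated to the left *)
Definition mass_prods (A0 : mass_problem) (As : seq mass_problem) :
  mass_problem := foldl mass_prod A0 As.

Definition mass_jump (f : baire) : mass_problem :=
  [set h | exists m g, [/\ turing_lt f g, Phi m g f & h = baire_cons m g]].

Definition medvedev_deg (A : mass_problem) : set mass_problem :=
  [set X | medvedev_equiv X A].

Definition medvedev_degrees : set (set mass_problem) := range medvedev_deg.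

Definition deg_le (a b : set mass_problem) : Prop :=
  exists A B, [/\ a A, b B & medvedev_le A B].

Definition deg_interval (a b : set mass_problem) : set (set mass_problem) :=
  [set x | [/\ medvedev_degrees x, deg_le a x & deg_le x b]].

Definition order_isomorphic (T U : Type)
    (A : set T) (leA : T -> T -> Prop) (B : set U) (leB : U -> U -> Prop) :
  Prop :=
  exists phi : T -> U, set_bij A B phi /\
    (forall x y, A x -> A y -> (leA x y <-> leB (phi x) (phi y))).

(* Main.v *)
Require Import Defs.
From Stdlib Require Cantor.
From mathcomp Require Import all_boot.
From mathcomp Require Import boolp classical_sets functions.

Local Open Scope classical_set_scope.

(* For a set I of indices let M(I) be the product of B with {f_i}' for i in I
   and {f_i} for i not in I.  Products are greatest lower bounds and
   {f} <= {f}' (run the given index on the given oracle, which takes a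
   universal program), so M is monotone with values in the interval.  If i is
   in I but not in J, then M(I) <= M(J) <= {f_i} would make f_i compute an
   element of B, some f_j with j <> i, or some g strictly above some f_j; all
   are excluded.  Hence M is an order embedding.

   It is onto: let X lie in the interval.  A reduction of the lower end to X
   splits X into a piece computing elements of B and pieces X_i computing f_i;
   the f_i are told apart by finitely many values.  If f_i computes some
   element of X_i then X <= {f_i}; otherwise every element of X_i lies strictly
   above f_i by one fixed index, so {f_i}' <= X_i.  Gluing the pieces gives
   X = M(I), where I is the set of indices of the second kind. *)

Arguments npair : simpl never.
Arguments nfst : simpl never.
Arguments nsnd : simpl never.

Lemma npairK1 a b : nfst (npair a b) = a.
Proof. by rewrite /nfst /npair Cantor.cancel_of_to. Qed.

Lemma npairK2 a b : nsnd (npair a b) = b.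
Proof. by rewrite /nsnd /npair Cantor.cancel_of_to. Qed.

Definition npairK := (npairK1, npairK2).

Lemma npair_eta x : npair (nfst x) (nsnd x) = x.
Proof.
by rewrite /npair /nfst /nsnd -surjective_pairing Cantor.cancel_to_of.
Qed.

(** * Total computable operators *)

Definition computable (F : baire -> nat -> nat) : Prop :=
  exists c, forall g x, eval g c x (F g x).

Definition CId : code := CPair CFst CSnd.

Lemma eval_CId g x : eval g CId x x.
Proof. by exists (nfst x), (nsnd x); rewrite npair_eta. Qed.

Lemma computable_id : computable (fun _ x => x).
Proof. by exists CId => g x; exact: eval_CId. Qed.

Lemma computable_succ F : computable F -> computable (fun g x => (F g x).+1).
Proof. by move=> [c cF]; exists (CComp CSucc c) => g x; exists (F g x). Qed.

Lemma computable_const n : computable (fun _ _ => n).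
Proof.
elim: n => [|n IHn]; first by exists CZero.
exact: computable_succ IHn.
Qed.

Lemma computable_nfst F : computable F -> computable (fun g x => nfst (F g x)).
Proof. by move=> [c cF]; exists (CComp CFst c) => g x; exists (F g x). Qed.

Lemma computable_nsnd F : computable F -> computable (fun g x => nsnd (F g x)).
Proof. by move=> [c cF]; exists (CComp CSnd c) => g x; exists (F g x). Qed.

Lemma computable_oracle F : computable F -> computable (fun g x => g (F g x)).
Proof. by move=> [c cF]; exists (CComp COracle c) => g x; exists (F g x). Qed.

Lemma computable_self : computable (fun g x => g x).
Proof. exact: computable_oracle computable_id. Qed.

Lemma computable_npair F G : computable F -> computable G ->
  computable (fun g x => npair (F g x) (G g x)).
Proof.
move=> [c cF] [d dG]; exists (CPair c d) => g x.
by exists (F g x), (G g x).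
Qed.

Lemma computable_iteri N A S : computable N -> computable A -> computable S ->
  computable (fun g x =>
    iteri (N g x) (fun k z => S g (npair x (npair k z))) (A g x)).
Proof.
move=> [n nN] [a aA] [s sS].
exists (CComp (CRec a s) (CPair CId n)) => g x.
exists (npair x (N g x)).
  by exists x, (N g x); split => //; exact: eval_CId.
rewrite /= !npairK; elim: (N g x) => [|k IHk]; first exact: aA.
by eexists; first exact: IHk.
Qed.

Lemma computable_comp F G : computable F -> computable G ->
  computable (fun g x => F g (G g x)).
Proof.
by move=> [c cF] [d dG]; exists (CComp c d) => g x; exists (G g x).
Qed.

Lemma computable_iter N A S : computable N -> computable A -> computable S ->
  computable (fun g x => iter (N g x) (S g) (A g x)).
Proof.
move=> cN cA cS.
have := computable_iteri _ _ _ cN cA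
  (computable_comp _ _ cS (computable_nsnd _ (computable_nsnd _ computable_id))).
move=> [c H]; exists c => g x; move: (H g x).
suff -> k a : iteri k (fun k z => S g (nsnd (nsnd (npair x (npair k z))))) a
  = iter k (S g) a by [].
by elim: k => //= k ->; rewrite !npairK.
Qed.

(** The step discards the accumulator and returns the round number, and the last of [k.+1] rounds
    has number [k]. *)
Lemma computable_pred F : computable F -> computable (fun g x => (F g x).-1).
Proof.
move=> cF; have [c H] := computable_iteri _ _ _ cF (computable_const 0)
  (computable_nfst _ (computable_nsnd _ computable_id)).
exists c => g x; move: (H g x); case: (F g x) => //= k.
by rewrite !npairK.
Qed.

(** The iteration starts at [A g x] and runs [F g x] rounds of a step that ignores its accumulator
    and returns [B g x]; no round leaves [A g x]. *)
Lemma computable_if0 F A B : computable F -> computable A -> computable B ->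
  computable (fun g x => if F g x == 0 then A g x else B g x).
Proof.
move=> cF cA cB; have [c H] := computable_iteri _ _ _ cF cA
  (computable_comp _ _ cB (computable_nfst _ computable_id)).
exists c => g x; move: (H g x); case: (F g x) => //= k.
by rewrite !npairK.
Qed.

Lemma computable_nth0 K : computable (fun g x => nth 0 [::] (K g x)).
Proof.
have [c H] := computable_const 0; exists c => g x.
by rewrite nth_nil.
Qed.

(** With [computable_nth0] this handles selection from an explicit list by recursion on the list, as
    in the transition table of the machine below. *)
Lemma computable_nth_cons K A L : computable K -> computable A ->
  computable (fun g x => nth 0 (L g x) (K g x).-1) ->
  computable (fun g x => nth 0 (A g x :: L g x) (K g x)).
Proof.
move=> cK cA cL; have [c H] := computable_if0 _ _ _ cK cA cL.
by exists c => g x; move: (H g x); case: (K g x).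
Qed.

Lemma computable_subn F G : computable F -> computable G ->
  computable (fun g x => F g x - G g x).
Proof.
move=> cF cG; have [c H] := computable_iter _ _ _ cG cF
  (computable_pred _ computable_id).
exists c => g x; move: (H g x).
suff -> k m : iter k predn m = m - k by [].
by elim: k => [|k /= ->]; rewrite ?subn0 ?subnS.
Qed.

Ltac computability := repeat first
  [ exact: computable_const | exact: computable_id
  | apply: computable_nth_cons | exact: computable_nth0
  | apply: computable_if0 | apply: computable_npair
  | apply: computable_nfst | apply: computable_nsnd
  | apply: computable_pred | apply: computable_succ
  | apply: computable_subn
  | apply: computable_oracle ].

(** Answering oracle queries by a program composes reductions; transitivity of both reducibilities
    rests on it. *)
Fixpoint code_subst (d c : code) : code :=
  match c with
  | COracle => d
  | CPair c1 c2 => CPair (code_subst d c1) (code_subst d c2)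
  | CComp c1 c2 => CComp (code_subst d c1) (code_subst d c2)
  | CRec c1 c2 => CRec (code_subst d c1) (code_subst d c2)
  | CMu c1 => CMu (code_subst d c1)
  | _ => c
  end.

Lemma eval_subst g h d c x y : (forall z, eval g d z (h z)) ->
  eval h c x y -> eval g (code_subst d c) x y.
Proof.
move=> dh; elim: c x y => [|||||c IHc e IHe|c IHc e IHe|c IHc e IHe|c IHc] x y //=.
- by move=> ->.
- by move=> [a [b [/IHc ca /IHe eb ->]]]; exists a, b.
- by move=> [z /IHe ez /IHc cz]; exists z.
- elim: (nsnd x) y => [|k IHk] y; first exact: IHc.
  by move=> [z /IHk rz /IHe ez]; exists z.
- by move=> [/IHc c0 lt]; split=> // k /lt[z /IHc cz]; exists z.
Qed.

(** * A universal program *)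

(* Programs are run by a machine whose state pairs a stack of frames (0 is the
   empty stack) with the current value.  A frame with tag at most 8 is the
   number of a program to be applied to the current value; tags 9 to 12 are the
   continuations of CPair (9 and 10), CRec and CMu. *)
Definition push (t K : nat) : nat := (npair t K).+1.

(** A frame with tag 11 holds the step program, the parameter, the stage whose value is [v], and the
    number of rounds left. One with tag 12 holds the program, the argument and the candidate whose
    value [v] is tested. *)
Definition action (g : baire) (t d K v : nat) : nat :=
  nth 0
  [:: npair K 0;
      npair K v.+1;
      npair K (nfst v);
      npair K (nsnd v);
      npair K (g v);
      npair (push (nfst d) (push (npair 9 (npair (nsnd d) v)) K)) v;
      npair (push (nsnd d) (push (nfst d) K)) v;
      npair (push (nfst d) (push (npair 11
        (npair (nsnd d) (npair (nfst v) (npair 0 (nsnd v))))) K)) (nfst v);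
      npair (push d (push (npair 12 (npair d (npair v 0))) K)) (npair v 0);
      npair (push (nfst d) (push (npair 10 v) K)) (nsnd d);
      npair K (npair d v);
      (let e := nfst d in let a := nfst (nsnd d) in
       let j := nfst (nsnd (nsnd d)) in let r := nsnd (nsnd (nsnd d)) in
       if r == 0 then npair K v else
       npair (push e (push (npair 11
         (npair e (npair a (npair j.+1 r.-1)))) K)) (npair a (npair j v)));
      (let e := nfst d in let x := nfst (nsnd d) in
       let m := nsnd (nsnd d) in
       if v == 0 then npair K m else
       npair (push e (push (npair 12 (npair e (npair x m.+1))) K))
         (npair x m.+1))] t.

(** Halted states are fixed points, so running past the halting stage changes nothing. *)
Definition step (g : baire) (s : nat) : nat :=
  if nfst s == 0 then s else
  let t := nfst (nfst s).-1 in
  action g (nfst t) (nsnd t) (nsnd (nfst s).-1) (nsnd s).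

Lemma stepE g t d K v :
  step g (npair (push (npair t d) K) v) = action g t d K v.
Proof. by rewrite /step npairK1 /push /= !npairK. Qed.

Lemma computable_step : computable step.
Proof. by rewrite /step /action /push; computability. Qed.

Definition reach (g : baire) (s s' : nat) : Prop :=
  exists k, iter k (step g) s = s'.

Lemma reach_trans g s1 s2 s3 : reach g s1 s2 -> reach g s2 s3 -> reach g s1 s3.
Proof. by move=> [k <-] [l <-]; exists (l + k); rewrite iterD. Qed.

Lemma reach_step g s s' : reach g (step g s) s' -> reach g s s'.
Proof. by move=> [k <-]; exists k.+1; rewrite iterSr. Qed.

Ltac machine := apply: reach_step; rewrite stepE /action /= ?npairK /=.

Lemma reach_refl g s : reach g s s.
Proof. by exists 0. Qed.

Lemma eval_CRec0 g c d a y :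
  eval g (CRec c d) (npair a 0) y = eval g c a y.
Proof. by rewrite /= !npairK. Qed.

Lemma eval_CRecS g c d a k y : eval g (CRec c d) (npair a k.+1) y =
  (exists2 z, eval g (CRec c d) (npair a k) z
            & eval g d (npair a (npair k z)) y).
Proof. by rewrite /= !npairK. Qed.

(** The stack [K] stays arbitrary in the induction, since subprograms run on top of continuation
    frames. *)
Lemma reach_eval g c x y K : eval g c x y ->
  reach g (npair (push (code_num c) K) x) (npair K y).
Proof.
elim: c x y K => [|||||c IHc d IHd|c IHc d IHd|c IHc d IHd|c IHc] x y K /=;
  try by move=> ->; machine; exact: reach_refl.
- move=> [a [b [/IHc ca /IHd db ->]]]; machine.
  apply: reach_trans (ca _) _; machine.
  apply: reach_trans (db _) _; machine.
  exact: reach_refl.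
- move=> [z /IHd dz /IHc cz]; machine.
  exact: reach_trans (dz _) (cz _).
- move=> H; machine.
  (* Loop invariant: of [k + r] rounds, [k] are done and [r] remain. The induction moves one round
     from [r] to [k], hence [r] is general. *)
  have main k r z : eval g (CRec c d) (npair (nfst x) k) z ->
    reach g (npair (push (code_num c) (push (npair 11 (npair (code_num d)
       (npair (nfst x) (npair 0 (k + r))))) K)) (nfst x))
     (npair (push (npair 11 (npair (code_num d)
       (npair (nfst x) (npair k r)))) K) z).
    elim: k r z => [|k IHk] r z; first by rewrite eval_CRec0; exact: IHc.
    rewrite eval_CRecS => -[w /(IHk r.+1) rw /IHd dz]; rewrite addSnnS.
    apply: reach_trans rw _; machine.
    exact: dz.
  have {}H : eval g (CRec c d) (npair (nfst x) (nsnd x)) y by rewrite npair_eta.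
  move/(main _ 0): H; rewrite addn0 => H; apply: reach_trans H _; machine.
  exact: reach_refl.
- move=> [/IHc c0 lt]; machine.
  (* Every candidate below [y] gives a nonzero value, so the search passes on to the next one. *)
  have main m : m <= y ->
    reach g (npair (push (code_num c) (push (npair 12 (npair (code_num c)
       (npair x 0))) K)) (npair x 0))
     (npair (push (code_num c) (push (npair 12 (npair (code_num c)
       (npair x m))) K)) (npair x m)).
    elim: m => [|m IHm] le_my; first exact: reach_refl.
    apply: reach_trans (IHm (ltnW le_my)) _.
    have [z /IHc cz] := lt _ le_my.
    apply: reach_trans (cz _) _; machine.
    exact: reach_refl.
  apply: reach_trans (main y (leqnn _)) _.
  apply: reach_trans (c0 _) _; machine.
  exact: reach_refl.
Qed.

Lemma universal_code : exists u, forall g c x y,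
  eval g c x y -> eval g u (npair (code_num c) x) y.
Proof.
pose run g w s := iter s (step g) (npair (push (nfst w) 0) (nsnd w)).
have crun : computable (fun g z => run g (nfst z) (nsnd z)).
  rewrite /run /push; apply: computable_iter; last exact: computable_step.
  - by computability.
  - by computability.
have [t ct] := computable_nfst _ crun.
have [o co] := computable_nsnd _ crun.
(* [CMu t] searches for the first stage with empty stack, and [o] reads the value at that stage. *)
exists (CComp o (CPair CId (CMu t))) => g c x y /(reach_eval _ _ _ _ 0) [k Hk].
set w := npair (code_num c) x.
have runk : run g w k = npair 0 y by rewrite /run !npairK.
have ex : exists s, nfst (run g w s) == 0.
  by exists k; rewrite runk npairK.
case: (ex_minnP ex) => s s0 smin.
have stop j : run g w (j + s) = run g w s.
  elim: j => //= j IHj; rewrite -/(run g w _) IHj.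
  by rewrite {1}/step s0.
have runs : run g w s = npair 0 y.
  by rewrite -runk -(stop (k - s)) subnK // smin // runk npairK.
exists (npair w s); last first.
  by have := co g (npair w s); rewrite !npairK runs npairK.
exists w, s; split=> //; first exact: eval_CId.
split=> [|j lt_js].
  by have := ct g (npair w s); rewrite !npairK runs npairK.
have := ct g (npair w j); rewrite !npairK.
case E: (nfst _) => [|z]; last by exists z.
by have := smin j; rewrite E eqxx leqNgt lt_js => /(_ isT).
Qed.

(** * Turing and Medvedev reducibility *)

Lemma medvedev_leP A B : medvedev_le A B <->
  exists c, forall g, B g -> exists2 f, A f & forall x, eval g c x (f x).
Proof.
split=> [[m Hm]|[c Hc]]; last first.
  by exists (code_num c) => g /Hc[f Af cf]; exists f => //; exists c.
have [[c cm]|nc] := pselect (exists c, code_num c = m).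
  exists c => g /Hm[f Af [d dm df]]; exists f => //.
  by have -> : c = d by apply: code_num_inj; rewrite cm dm.
(* If [m] numbers no program, the assumed reduction forces [B] to be empty, and any program
   serves. *)
by exists CZero => g /Hm[f Af [d dm _]]; case: nc; exists d.
Qed.

Lemma turing_leP f g : turing_le f g <-> exists c, forall x, eval g c x (f x).
Proof.
split=> [[m [c _ cf]]|[c cf]]; first by exists c.
by exists (code_num c), c.
Qed.

Lemma turing_le_trans f g h : turing_le f g -> turing_le g h -> turing_le f h.
Proof.
move=> /turing_leP[c cf] /turing_leP[d dg]; apply/turing_leP.
by exists (code_subst d c) => x; exact: eval_subst dg (cf x).
Qed.

Lemma turing_le_computable F g : computable F -> turing_le (F g) g.
Proof. by move=> [c cF]; apply/turing_leP; exists c. Qed.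

Lemma computable_subst F G : computable F -> computable G ->
  computable (fun g x => F (G g) x).
Proof.
move=> [c cF] [d dG]; exists (code_subst d c) => g x.
exact: eval_subst (dG g) (cF _ x).
Qed.

Lemma medvedev_le_trans A B C :
  medvedev_le A B -> medvedev_le B C -> medvedev_le A C.
Proof.
move=> /medvedev_leP[c cA] /medvedev_leP[d dB]; apply/medvedev_leP.
exists (code_subst d c) => g /dB[h /cA[f Af cf] dh]; exists f => // x.
exact: eval_subst dh (cf x).
Qed.

Lemma medvedev_le_computable F A B : computable F ->
  (forall g, B g -> A (F g)) -> medvedev_le A B.
Proof.
by move=> [c cF] BA; apply/medvedev_leP; exists c => g /BA; exists (F g).
Qed.

Lemma medvedev_le_refl A : medvedev_le A A.
Proof.
by apply: (@medvedev_le_computable (fun g x => g x)) => //; exact: computable_self.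
Qed.

Lemma medvedev_le_set1 A f g : A f -> turing_le f g -> medvedev_le A [set g].
Proof.
move=> Af /turing_leP[c cf]; apply/medvedev_leP.
by exists c => _ ->; exists f.
Qed.

Definition baire_tail (g : baire) : baire := fun x => g x.+1.

Lemma computable_tail : computable baire_tail.
Proof. by rewrite /baire_tail; computability. Qed.

Lemma computable_cons n : computable (baire_cons n).
Proof.
have [c H] : computable (fun g x => if x == 0 then n else g x.-1).
  by computability.
by exists c => g x; move: (H g x); case: x.
Qed.

Lemma computable_table s K : computable K ->
  computable (fun g x => nth 0 s (K g x)).
Proof.
elim: s K => [|a s IHs] K cK; first exact: computable_nth0.
apply: computable_nth_cons; [exact: cK|exact: computable_const|].
exact: IHs (computable_pred _ cK).
Qed.

(* The universal program lets a computed index select among finitely many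
   reductions without running the ones that were not selected. *)
Lemma medvedev_le_glue C X c N :
  (forall g, X g -> exists2 k, k < N & eval g c 0 k) ->
  (forall k, k < N -> medvedev_le C [set g | X g /\ eval g c 0 k]) ->
  medvedev_le C X.
Proof.
move=> cX CX.
have /choice[d Hd] : forall k, exists d, k < N ->
    forall g, X g /\ eval g c 0 k ->
    exists2 f, C f & forall x, eval g d x (f x).
  move=> k; have [/CX/medvedev_leP[d Hd]|_] := ltnP k N; last by exists CZero.
  by exists d => _.
have [u Hu] := universal_code.
have [t Ht] := computable_table (mkseq (code_num \o d) N) _ computable_id.
apply/medvedev_leP.
exists (CComp u (CPair (CComp t (CComp c CZero)) CId)) => g Xg.
have [k ltkN ck] := cX g Xg.
have [f Cf df] := Hd k ltkN g (conj Xg ck).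
exists f => // x; exists (npair (code_num (d k)) x); last exact: Hu.
exists (code_num (d k)), x; split=> //; last exact: eval_CId.
exists k; first by exists 0.
by have := Ht g k; rewrite nth_mkseq.
Qed.

Lemma mass_prod_lel A B : medvedev_le (mass_prod A B) A.
Proof.
apply: (@medvedev_le_computable (baire_cons 0)); first exact: computable_cons.
by move=> g Ag; left; exists g.
Qed.

Lemma mass_prod_ler A B : medvedev_le (mass_prod A B) B.
Proof.
apply: (@medvedev_le_computable (baire_cons 1)); first exact: computable_cons.
by move=> g Bg; right; exists g.
Qed.

(** The leading value, read by [COracle] at 0, tells the factor; [baire_tail] then recovers the
    element of it. *)
Lemma mass_prod_glb A B C :
  medvedev_le C A -> medvedev_le C B -> medvedev_le C (mass_prod A B).
Proof.
move=> CA CB; apply: (@medvedev_le_glue _ _ COracle 2).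
  by move=> g [[h _ <-]|[h _ <-]]; [exists 0|exists 1].
move=> [|[|//]] _.
- apply: medvedev_le_trans CA _.
  apply: (@medvedev_le_computable baire_tail); first exact: computable_tail.
  by move=> g [[[h Ah <-]|[h Bh <-]]].
- apply: medvedev_le_trans CB _.
  apply: (@medvedev_le_computable baire_tail); first exact: computable_tail.
  by move=> g [[[h Ah <-]|[h Bh <-]]].
Qed.

Lemma mass_prods_le0 A0 As : medvedev_le (mass_prods A0 As) A0.
Proof.
elim: As A0 => [|A As IH] A0 /=; first exact: medvedev_le_refl.
exact: medvedev_le_trans (IH _) (mass_prod_lel _ _).
Qed.

Lemma mass_prods_le (I : eqType) (F : I -> mass_problem) A0 s i : i \in s ->
  medvedev_le (mass_prods A0 [seq F j | j <- s]) (F i).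
Proof.
elim: s A0 => [//|j s IH] A0; rewrite inE => /predU1P[->|/IH]; last exact.
exact: medvedev_le_trans (mass_prods_le0 _ _) (mass_prod_ler _ _).
Qed.

Lemma mass_prods_glb (I : eqType) (F : I -> mass_problem) A0 s C :
  medvedev_le C A0 -> (forall i, i \in s -> medvedev_le C (F i)) ->
  medvedev_le C (mass_prods A0 [seq F j | j <- s]).
Proof.
elim: s A0 => [//|j s IH] A0 CA0 CF /=; apply: IH => [|i si].
- by apply: mass_prod_glb => //; apply: CF; rewrite mem_head.
- by apply: CF; rewrite inE si orbT.
Qed.

Lemma mass_prods_inv (I : eqType) (F : I -> mass_problem) A0 s h :
  mass_prods A0 [seq F j | j <- s] h ->
  (exists2 b, A0 b & turing_le b h) \/
  (exists i b, [/\ i \in s, F i b & turing_le b h]).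
Proof.
have consP n g : turing_le g (baire_cons n g).
  exact: turing_le_computable computable_tail.
elim: s A0 => [|j s IH] A0 /=.
  by left; exists h => //; exact: turing_le_computable computable_self.
case/IH=> [[b [[g Ag <-]|[g Fg <-]] le]|[i [b [si Fb le]]]].
- by left; exists g => //; exact: turing_le_trans (consP _ _) le.
- right; exists j, g; split; rewrite ?mem_head //.
  exact: turing_le_trans (consP _ _) le.
- by right; exists i, b; split; rewrite // inE si orbT.
Qed.

Lemma set1_le_mass_jump f : medvedev_le [set f] (mass_jump f).
Proof.
have [u Hu] := universal_code; have [d Hd] := computable_tail.
apply/medvedev_leP.
(* [COracle] at 0 reads the index; [code_subst d u] runs it with the tail as oracle. *)
exists (CComp (code_subst d u) (CPair (CComp COracle CZero) CId)).
move=> _ [m [g [_ [c <- cf] ->]]]; exists f => // x.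
exists (npair (code_num c) x); last exact: eval_subst (Hd _) (Hu _ _ _ _ (cf x)).
by exists (code_num c), x; split=> //; [exists 0|exact: eval_CId].
Qed.

Lemma mass_jump_le f X c :
  (forall h, X h -> ~ turing_le h f /\ forall x, eval h c x (f x)) ->
  medvedev_le (mass_jump f) X.
Proof.
move=> Xf; apply: (@medvedev_le_computable (baire_cons (code_num c))).
  exact: computable_cons.
move=> h /Xf[nle cf]; exists (code_num c), h; split=> //; last by exists c.
by split=> //; apply/turing_leP; exists c.
Qed.

(** [D] compares its oracle with each [f j] at finitely many points of disagreement. It is total: on
    oracles outside the family its answer is arbitrary. *)
Lemma finite_index n (f : 'I_n -> baire) : injective f ->
  exists2 D, computable D & forall i x, D (f i) x = i.
Proof.
move=> injf.
have sep j (s : seq 'I_n) : exists2 C, computable C & forall x,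
    C (f j) x = 0 /\ forall i, i \in s -> i <> j -> C (f i) x != 0.
  elim: s => [|k s [C cC HC]].
    by exists (fun _ _ => 0) => //; exact: computable_const.
  have [->|/eqP nkj] := eqVneq k j.
    exists C => // x; have [? CN] := HC x; split=> // i.
    by rewrite inE => /predU1P[//|]; exact: CN.
  have [z nz] : exists z, f k z <> f j z.
    by apply/existsNP => E; apply/nkj/injf/funext.
  (* Both truncated differences vanish exactly when [g] agrees with [f j] at [z], where [f k] does
     not. *)
  exists (fun g x => if g z - f j z == 0 then
                     if f j z - g z == 0 then C g x else 1 else 1).
    by computability.
  move=> x; have [C0 CN] := HC x; split; first by rewrite subnn.
  move=> i; rewrite inE !subn_eq0 => si nij.
  case: (ltngtP (f i z) (f j z)) => // E.
  by case/predU1P: si => [ik|/CN]; [case: nz; rewrite -ik|exact].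
suff [D cD HD] : exists2 D, computable D &
    forall i x, i \in enum 'I_n -> D (f i) x = i.
  by exists D => // i x; rewrite HD // mem_enum.
elim: (enum 'I_n) => [|j s [D cD HD]].
  by exists (fun _ _ => 0) => //; exact: computable_const.
have [C cC HC] := sep j (enum 'I_n).
exists (fun g x => if C g x == 0 then val j else D g x).
  by computability.
move=> i x; rewrite inE; have [C0 CN] := HC x.
have [->|/eqP nij /= /HD ->] := eqVneq i j; first by rewrite C0.
by rewrite (negbTE (CN _ _ nij)) // mem_enum.
Qed.

(** * The products M(I) *)

Definition jump_at {n} (f : 'I_n -> baire) (I : {set 'I_n}) (i : 'I_n) :
  mass_problem := if i \in I then mass_jump (f i) else [set f i].

Definition jump_prod B {n} (f : 'I_n -> baire) (I : {set 'I_n}) : mass_problem :=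
  mass_prods B [seq jump_at f I i | i <- enum 'I_n].

Lemma jump_prod_glb B n (f : 'I_n -> baire) I C : medvedev_le C B ->
  (forall i, medvedev_le C (jump_at f I i)) -> medvedev_le C (jump_prod B f I).
Proof. by move=> CB Cf; exact: mass_prods_glb. Qed.

Lemma jump_prod_le0 B n (f : 'I_n -> baire) I : medvedev_le (jump_prod B f I) B.
Proof. exact: mass_prods_le0. Qed.

Lemma jump_prod_le B n (f : 'I_n -> baire) I i :
  medvedev_le (jump_prod B f I) (jump_at f I i).
Proof. by apply: mass_prods_le; rewrite mem_enum. Qed.

Lemma jump_prod_setT B n (f : 'I_n -> baire) :
  jump_prod B f [set: 'I_n] = mass_prods B [seq mass_jump (f i) | i <- enum 'I_n].
Proof.
by congr mass_prods; apply: eq_map => i; rewrite /jump_at finset.in_setT.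
Qed.

Lemma jump_prod_mono B n (f : 'I_n -> baire) (I J : {set 'I_n}) : I \subset J ->
  medvedev_le (jump_prod B f I) (jump_prod B f J).
Proof.
move=> /fintype.subsetP sIJ; apply: jump_prod_glb => [|i]; first exact: jump_prod_le0.
apply: medvedev_le_trans (jump_prod_le B n f I i) _; rewrite /jump_at.
case: ifPn => [/sIJ ->|_]; first exact: medvedev_le_refl.
by case: ifP => _; [exact: set1_le_mass_jump|exact: medvedev_le_refl].
Qed.

Lemma le_jump_prod B n (f : 'I_n -> baire) I :
  medvedev_le (mass_prod B (range f)) (jump_prod B f I).
Proof.
apply: jump_prod_glb => [|i]; first exact: mass_prod_lel.
apply: medvedev_le_trans (mass_prod_ler _ _) _.
apply: (@medvedev_le_trans _ [set f i]).
  apply: (@medvedev_le_set1 _ (f i)); first by exists i.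
  exact: turing_le_computable computable_self.
by rewrite /jump_at; case: ifP => _;
  [exact: set1_le_mass_jump|exact: medvedev_le_refl].
Qed.

Lemma jump_prod_subset B n (f : 'I_n -> baire) (I J : {set 'I_n}) :
  (forall i j : 'I_n, i <> j -> turing_incomparable (f i) (f j)) ->
  (forall i : 'I_n, ~ medvedev_le B [set f i]) ->
  medvedev_le (jump_prod B f I) (jump_prod B f J) -> I \subset J.
Proof.
move=> hinc hB le; apply/fintype.subsetP => i iI; apply: contrapT => /negP iJ.
have := medvedev_le_trans _ _ _ le (jump_prod_le B n f J i).
rewrite /jump_at (negbTE iJ) => /medvedev_leP[c /(_ _ erefl)[h Mh ch]].
have hi : turing_le h (f i) by apply/turing_leP; exists c.
case: (mass_prods_inv _ _ _ _ _ Mh) => [[b Bb bh]|[j [b [_ jb bh]]]].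
  exact: (hB i (medvedev_le_set1 _ _ _ Bb (turing_le_trans _ _ _ bh hi))).
have bi := turing_le_trans _ _ _ bh hi.
move: jb; rewrite /jump_at; case: ifPn => [jI|jI].
  move=> [m [g [[fg gf] _ bE]]].
  have gi : turing_le g (f i).
    apply: turing_le_trans bi; rewrite bE.
    exact: (turing_le_computable _ (baire_cons m g) computable_tail).
  (* For [j = i], [g] below [f i] contradicts that [g] lies strictly above [f j]; otherwise [f j] is
     below [g], hence below [f i], against incomparability. *)
  have [ij|nij] := pselect (j = i); first by apply: gf; rewrite ij.
  by have [nle _] := hinc _ _ nij; apply/nle/(turing_le_trans _ _ _ fg gi).
move=> bE; rewrite bE in bi.
have nij : j <> i by move=> ij; move: jI; rewrite ij iI.
by have [] := hinc _ _ nij.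
Qed.

Lemma jump_prod_classification B n (f : 'I_n -> baire) X : injective f ->
  medvedev_le (mass_prod B (range f)) X ->
  medvedev_le X (jump_prod B f [set: 'I_n]) ->
  exists I, medvedev_equiv X (jump_prod B f I).
Proof.
move=> injf /medvedev_leP[c cX] XU.
have [D cD HD] := finite_index n f injf.
(* Piece number of an element of the lower end: 0 for the side of [B], and [i.+1] for [f i]. *)
have cT : computable (fun g _ => if g 0 == 0 then 0 else (D (baire_tail g) 0).+1).
  computability; have [d Hd] := computable_subst _ _ cD computable_tail.
  by exists (CComp d CZero) => g x; exists 0.
have {cT} [t Ht] := cT; have [tl Htl] := computable_tail.
pose q := code_subst c t.
pose piece k := [set g | X g /\ eval g q 0 k].
have caseX g : X g ->
    (exists2 b, B b & eval g q 0 0 /\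
      forall x, eval g (code_subst c tl) x (b x)) \/
    (exists i : 'I_n, eval g q 0 i.+1 /\
      forall x, eval g (code_subst c tl) x (f i x)).
  move=> /cX[h Lh ch].
  have qh := eval_subst _ _ _ _ _ _ ch (Ht h 0).
  have th x := eval_subst _ _ _ _ _ _ ch (Htl h x).
  case: Lh => [[b Bb hE]|[_ [i _ <-] hE]]; subst h.
    by left; exists b.
  by right; exists i; split=> //; move: qh; rewrite /= HD.
have piece0 : medvedev_le B (piece 0).
  apply/medvedev_leP; exists (code_subst c tl) => g [Xg q0].
  case: (caseX g Xg) => [[b Bb [_ bE]]|[i [qi _]]]; first by exists b.
  by have := eval_functional q0 qi.
have pieceS g (i : 'I_n) : piece i.+1 g ->
    forall x, eval g (code_subst c tl) x (f i x).
  move=> [Xg qi]; case: (caseX g Xg) => [[b _ [q0 _]]|[j [qj jE]]].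
    by have := eval_functional q0 qi.
  by have [/val_inj ->] := eval_functional qi qj.
(* Membership is decided classically; an empty piece puts [i] into [I]. *)
pose I := finset (fun i : 'I_n =>
  `[< forall h, piece i.+1 h -> ~ turing_le h (f i) >]).
have inI i : i \in I = `[< forall h, piece i.+1 h -> ~ turing_le h (f i) >].
  by rewrite finset.inE.
exists I; split.
  apply: jump_prod_glb => [|i].
    exact: medvedev_le_trans XU (jump_prod_le0 _ _ _ _).
  have := jump_prod_le B n f finset.setT i.
  move=> /(medvedev_le_trans _ _ _ XU); rewrite /jump_at finset.in_setT inI.
  case: asboolP => // nI _.
  have /existsNP[h /not_implyP[[Xh _] /contrapT hi]] := nI.
  exact: medvedev_le_set1 Xh hi.
(* The pieces 0 to [n] cover [X], and [q] computes the piece number. *)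
apply: (@medvedev_le_glue _ _ q n.+1) => [g /caseX|[_|k]].
- case=> [[b _ [q0 _]]|[i [qi _]]]; first by exists 0.
  by exists i.+1; rewrite ?ltnS ?ltn_ord.
- exact: (medvedev_le_trans _ _ _ (jump_prod_le0 B n f I) piece0).
rewrite ltnS => ltkn; pose i := Ordinal ltkn.
apply: medvedev_le_trans (jump_prod_le B n f I i) _.
rewrite /jump_at inI; case: asboolP => [iI|_].
  apply: (@mass_jump_le _ _ (code_subst c tl)) => h ph.
  by split; [exact: iI|exact: (pieceS h i ph)].
apply/medvedev_leP; exists (code_subst c tl) => g pg.
by exists (f i) => //; exact: (pieceS g i pg).
Qed.

(** * Passage to degrees and the isomorphism *)

Lemma medvedev_deg_eq A B : medvedev_deg A = medvedev_deg B <-> medvedev_equiv A B.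
Proof.
split=> [E|[AB BA]].
  have : medvedev_deg A A by split; exact: medvedev_le_refl.
  by rewrite E.
apply/seteqP; split=> X [XA AX]; split.
- exact: medvedev_le_trans XA AB.
- exact: medvedev_le_trans BA AX.
- exact: medvedev_le_trans XA BA.
- exact: medvedev_le_trans AB AX.
Qed.

Lemma deg_leE A B :
  deg_le (medvedev_deg A) (medvedev_deg B) <-> medvedev_le A B.
Proof.
split=> [[X [Y [[_ AX] [YB _] XY]]]|AB].
  exact: medvedev_le_trans AX (medvedev_le_trans _ _ _ XY YB).
by exists A, B; split=> //; split; exact: medvedev_le_refl.
Qed.

Theorem theorem2p8 (B : mass_problem) (n : nat) (f : 'I_n -> baire)
  (hn : 1 <= n)
  (hinc : forall i j : 'I_n, i <> j -> turing_incomparable (f i) (f j))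
  (hB : forall i : 'I_n, ~ medvedev_le B [set f i]) :
  order_isomorphic
    (deg_interval
       (medvedev_deg (mass_prod B (range f)))
       (medvedev_deg (mass_prods B [seq mass_jump (f i) | i <- enum 'I_n])))
    deg_le
    [set: {set 'I_n}] (fun I J : {set 'I_n} => I \subset J).
Proof.
have injf : injective f.
  move=> i j E; apply: contrapT => /hinc[]; rewrite E => nle _; apply: nle.
  exact: turing_le_computable computable_self.
pose M := jump_prod B f.
have subM I J : medvedev_le (M I) (M J) <-> I \subset J.
  by split; [exact: jump_prod_subset|exact: jump_prod_mono].
rewrite -jump_prod_setT; set iv := deg_interval _ _.
have ivM I : iv (medvedev_deg (M I)).
  split; first by exists (M I).
  - by apply/deg_leE; exact: le_jump_prod.
  - by apply/deg_leE/subM/fintype.subsetP => i _; rewrite finset.in_setT.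
have exM x : iv x -> exists I, x = medvedev_deg (M I).
  move=> [[X _ <-] /deg_leE LX /deg_leE XU].
  have [I XI] := jump_prod_classification B n f X injf LX XU.
  by exists I; apply/medvedev_deg_eq.
(* [phi] inverts the map from [I] to the degree of [M I]; outside the interval its value is
   arbitrary. *)
have /choice[phi phiP] x : exists I, iv x -> x = medvedev_deg (M I).
  have [/exM[I ->]|nx] := pselect (iv x); first by exists I.
  by exists finset.set0.
have le_phi x y : iv x -> iv y -> deg_le x y <-> phi x \subset phi y.
  by move=> /phiP {1}-> /phiP {1}->; rewrite deg_leE.
exists phi; split=> //; split=> //.
- by move=> x y /set_mem /phiP {2}-> /set_mem /phiP {2}-> ->.
- move=> I _; exists (medvedev_deg (M I)) => //.
  (* [M I] and [M (phi (medvedev_deg (M I)))] are equivalent, so the order embedding gives both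
     inclusions. *)
  have /phiP /medvedev_deg_eq[le ge] := ivM I.
  by apply/eqP; rewrite finset.eqEsubset; apply/andP; split; exact/subM.
Qed.
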